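(* Let $G$ be a connected graph on $n\ge2$ vertices with resistance Laplacian $\mathcal R$ and $\rho=\lambda_{\max}(\mathcal R)$. Let $0=\lambda_1<\lambda_2\le\cdots\le\lambda_n$ be the Laplacian eigenvalues with corresponding orthonormal eigenvectors $u_1=\frac1{\sqrt n}\mathbf 1,u_2,\dots,u_n$, and let $U=[u_2\ \cdots\ u_n]$, $D_L=\operatorname{diag}(1/\lambda_2,\dots,1/\lambda_n)$, $M_L=U^\top\Delta U$. For $a=(a_2,\dots,a_n)^\top\in\mathbb R^{n-1}$, the vector $w=Ua$ is a unit eigenvector of $\mathcal R$ associated with $\rho$ if and only if $a$ is a maximizer of \[ \max_{\|a\|=1}\bigl(2a^\top D_La+n\,a^\top M_La\bigr). \] Equivalently, every such maximizer satisfies \[ (2D_L+nM_L)a=(\rho-2n\bar d)\,a . \]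
   Context: $G=(V,E)$ is a finite, simple, connected, undirected, unweighted graph with vertex set $V=\{1,\dots,n\}$. $L=D_G-A$ is its combinatorial Laplacian (degree matrix minus adjacency matrix). $\mathbf 1\in\mathbb R^n$ is the all-ones vector, $I$ the identity matrix, $\|\cdot\|$ the Euclidean norm. $L^\dagger$ is the Moore--Penrose inverse of $L$, i.e. the unique symmetric matrix with $LL^\dagger=L^\dagger L=I-\frac1n\mathbf 1\mathbf 1^\top$ and $L^\dagger\mathbf 1=\mathbf 0$. The effective resistance is $r_{ij}=(L^\dagger)_{ii}+(L^\dagger)_{jj}-2(L^\dagger)_{ij}$, the resistance matrix is $R=(r_{ij})$, and the resistance Laplacian is $\mathcal R=\operatorname{diag}(R\mathbf 1)-R$. Put $d_i=(L^\dagger)_{ii}$, $D=\operatorname{diag}(d_1,\dots,d_n)$, $\bar d=\frac1n\operatorname{tr}(L^\dagger)$, $\Delta=D-\bar d I$ (resistance deviation matrix). A maximizer is a vector $a$ with $\|a\|=1$ attaining the maximum. *)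

(* Defs.v *)
From HB Require Import structures.
From mathcomp Require Import all_boot all_order all_algebra.
From mathcomp Require Import reals.

Set Implicit Arguments.
Unset Strict Implicit.
Unset Printing Implicit Defensive.

Import Order.TTheory GRing.Theory Num.Theory.
Local Open Scope ring_scope.

(* Indices are 0-based: the i-th object of the mathematics, 1 <= i <= n,
   sits at the ordinal i - 1 of 'I_n. *)

Section Vectors.
Variables (R : realType) (n : nat).

Definition ones : 'cV[R]_n := const_mx 1.

Definition enorm (v : 'cV[R]_n) : R := Num.sqrt (\sum_i v i 0 ^+ 2).

Definition dot (v w : 'cV[R]_n) : R := (v^T *m w) 0 0.

Definition qform (M : 'M[R]_n) (v : 'cV[R]_n) : R := (v^T *m M *m v) 0 0.

Definition is_lambda_max (M : 'M[R]_n) (r : R) : Prop :=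
  eigenvalue M r /\ (forall mu : R, eigenvalue M mu -> mu <= r).

(* [eigenvalue] concerns row vectors; eigenvectors here are columns. *)
Definition unit_eigenvector (M : 'M[R]_n) (r : R) (w : 'cV[R]_n) : Prop :=
  enorm w = 1 /\ M *m w = r *: w.

Definition is_sphere_maximizer (f : 'cV[R]_n -> R) (a : 'cV[R]_n) : Prop :=
  enorm a = 1 /\ (forall b : 'cV[R]_n, enorm b = 1 -> f b <= f a).

End Vectors.

Definition is_simple_graph (n : nat) (e : rel 'I_n) : Prop :=
  symmetric e /\ irreflexive e.

Definition is_connected (n : nat) (e : rel 'I_n) : Prop :=
  forall x y : 'I_n, connect e x y.

Section Laplacian.
Variables (R : realType) (n : nat) (e : rel 'I_n).

Definition adjacency : 'M[R]_n := \matrix_(i, j) (e i j)%:R.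

Definition degree_mx : 'M[R]_n := diag_mx (\row_i #|[set j | e i j]|%:R).

Definition laplacian : 'M[R]_n := degree_mx - adjacency.

Definition is_laplacian_pinv (Ld : 'M[R]_n) : Prop :=
  let P : 'M[R]_n := 1%:M - n%:R^-1 *: (ones R n *m (ones R n)^T) in
  [/\ Ld^T = Ld, laplacian *m Ld = P, Ld *m laplacian = P
    & Ld *m ones R n = 0].

Definition is_laplacian_eigensystem
    (lam : 'I_n -> R) (u : 'I_n -> 'cV[R]_n) : Prop :=
  [/\ forall i : 'I_n, laplacian *m u i = lam i *: u i,
      forall i j : 'I_n, dot (u i) (u j) = (i == j)%:R,
      forall i : 'I_n, i = 0%N :> nat ->
        lam i = 0 /\ u i = (Num.sqrt n%:R)^-1 *: ones R n,
      forall i : 'I_n, i = 1%N :> nat -> 0 < lam i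
    & forall i j : 'I_n, (i <= j)%N -> lam i <= lam j].

End Laplacian.

(* Below, Ld stands for the Moore-Penrose inverse of the Laplacian. *)
Section Resistance.
Variables (R : realType) (n : nat) (Ld : 'M[R]_n).

Definition resistance_mx : 'M[R]_n :=
  \matrix_(i, j) (Ld i i + Ld j j - 2 * Ld i j).

Definition resistance_laplacian : 'M[R]_n :=
  diag_mx (resistance_mx *m ones R n)^T - resistance_mx.

Definition dbar : R := n%:R^-1 * \tr Ld.

Definition resistance_deviation : 'M[R]_n :=
  diag_mx (\row_i Ld i i) - dbar%:M.

End Resistance.

Section NontrivialPart.
Variables (R : realType) (n : nat).

Definition ord_next (j : 'I_n.-1) : 'I_n :=
  Ordinal (etrans (esym (ltn_predRL j n)) (ltn_ord j)).

Definition U_mx (u : 'I_n -> 'cV[R]_n) : 'M[R]_(n, n.-1) :=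
  \matrix_(i, j) u (ord_next j) i 0.

Definition DL_mx (lam : 'I_n -> R) : 'M[R]_n.-1 :=
  diag_mx (\row_j (lam (ord_next j))^-1).

Definition ML_mx (Ld : 'M[R]_n) (u : 'I_n -> 'cV[R]_n) : 'M[R]_n.-1 :=
  (U_mx u)^T *m resistance_deviation Ld *m U_mx u.

Definition objective (Ld : 'M[R]_n) (lam : 'I_n -> R) (u : 'I_n -> 'cV[R]_n)
    (a : 'cV[R]_n.-1) : R :=
  2 * qform (DL_mx lam) a + n%:R * qform (ML_mx Ld u) a.

End NontrivialPart.

(* Main.v *)
Require Import Defs.
From HB Require Import structures.
From mathcomp Require Import all_boot all_order all_algebra.
From mathcomp Require Import reals.
From mathcomp Require Import complex ring lra.

Set Implicit Arguments.
Unset Strict Implicit.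
Unset Printing Implicit Defensive.

Import Order.TTheory GRing.Theory Num.Theory.
Local Open Scope ring_scope.

(** Write calR for the resistance Laplacian, U for the matrix of nontrivial
    Laplacian eigenvectors and c for 2 n dbar. Since Ld kills the all-ones
    vector,
      calR = n Delta + 2 Ld + c I - (d 1^T + 1 d^T),
    where d is the diagonal of Ld ([resistance_laplacianE]). The last term
    vanishes on the orthogonal complement of 1, which the columns of U span,
    and Ld acts there as D_L in the coordinates given by U ([U_mx_pinv]). As
    calR maps into this complement, U intertwines calR with 2 D_L + n M_L + c I
    ([resistance_laplacian_U]). So the objective at a unit vector a is the
    quadratic form of calR at the unit vector U a, lowered by c, and the
    equation (2 D_L + n M_L) a = (rho - c) a says that U a is an eigenvector of
    calR for rho.

    What remains is the variational principle: a unit vector a is a maximizer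
    if and only if calR (U a) = rho U a. The form of calR is at most
    rho |v|^2 because rho is the largest eigenvalue
    ([qform_le_eigenvalue], from the spectral theorem), so eigenvectors are
    maximizers. Conversely the value of the form at a maximizer is at least
    rho: if rho <> 0, an eigenvector for rho is orthogonal to 1, hence of
    the form U b, and competes in the maximization; if rho = 0, nonnegativity
    of the form suffices. That form is nonnegative since calR is a Laplacian
    with nonnegative weights, the resistances. Finally rho I - calR is positive
    semidefinite and its form vanishes at U a, which forces U a into its kernel
    ([psd_kernel]). *)

(** * Dot products and quadratic forms *)

Lemma dotE (R : realType) n (v w : 'cV[R]_n) :
  dot v w = \sum_i v i 0 * w i 0.
Proof. by rewrite /dot mxE; apply: eq_bigr => i _; rewrite mxE. Qed.

Lemma dotZr (R : realType) n (k : R) (v w : 'cV[R]_n) :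
  dot v (k *: w) = k * dot v w.
Proof. by rewrite /dot -scalemxAr mxE. Qed.

Lemma dotZl (R : realType) n (k : R) (v w : 'cV[R]_n) :
  dot (k *: v) w = k * dot v w.
Proof. by rewrite !dotE mulr_sumr; apply: eq_bigr => i _; rewrite mxE mulrA. Qed.

Lemma dot_ge0 (R : realType) n (v : 'cV[R]_n) : 0 <= dot v v.
Proof. by rewrite dotE sumr_ge0 // => i _; rewrite -expr2 sqr_ge0. Qed.

Lemma dot_eq0 (R : realType) n (v : 'cV[R]_n) : dot v v = 0 -> v = 0.
Proof.
rewrite dotE => /psumr_eq0P v0; apply/colP => i; rewrite mxE.
have /eqP := v0 (fun j _ => sqr_ge0 (v j 0)) i isT.
by rewrite mulf_eq0 orbb => /eqP.
Qed.

Lemma enorm_eq1 (R : realType) n (v : 'cV[R]_n) : enorm v = 1 <-> dot v v = 1.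
Proof.
have -> : enorm v = Num.sqrt (dot v v).
  by rewrite /enorm dotE; congr Num.sqrt; apply: eq_bigr => i _; rewrite expr2.
split=> [v1|->]; last exact: sqrtr1.
by rewrite -[LHS]sqr_sqrtr ?dot_ge0 // v1 expr1n.
Qed.

Lemma qform_dot (R : realType) n (M : 'M[R]_n) (v : 'cV[R]_n) :
  qform M v = dot v (M *m v).
Proof. by rewrite /qform /dot mulmxA. Qed.

Lemma qform_scalar_sub (R : realType) n (M : 'M[R]_n) (r : R) (v : 'cV[R]_n) :
  qform (r%:M - M) v = r * dot v v - qform M v.
Proof.
rewrite /qform /dot mulmxBr mulmxBl mul_mx_scalar -scalemxAl.
rewrite mxE; congr (_ + _); first by rewrite mxE.
by rewrite mxE.
Qed.

(** Along the line v + t M v the form is 2 t |M v|^2 + O(t^2), which would be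
    negative for some small t < 0 if M v were nonzero. *)
Lemma psd_kernel (R : realType) n (M : 'M[R]_n) (v : 'cV[R]_n) :
  M^T = M -> (forall w, 0 <= qform M w) -> qform M v = 0 -> M *m v = 0.
Proof.
move=> symM psdM Mv0; apply: dot_eq0.
set w := M *m v; set s := dot w w; set q := qform M w.
have expand t : qform M (v + t *: w) = 2 * t * s + t ^+ 2 * q.
  rewrite /qform.
  have wMv : v^T *m M = w^T by rewrite /w trmx_mul symM.
  have -> : (v + t *: w)^T = v^T + t *: w^T by apply/matrixP => i j; rewrite !mxE.
  rewrite mulmxDl -scalemxAl wMv !mulmxDr !mulmxDl.
  rewrite -!scalemxAl -!scalemxAr -[_ *m M *m v]mulmxA -/w.
  have -> : w^T *m v = v^T *m M *m v by rewrite wMv.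
  move: Mv0; rewrite /qform /s /q /qform /dot.
  move: (v^T *m M *m v) (w^T *m w) (w^T *m M *m w) => A B C A0.
  by rewrite !mxE A0; ring.
have q_ge0 : 0 <= q by apply: psdM.
have s_ge0 : 0 <= s by apply: dot_ge0.
(* the form 2 t s + t^2 q is negative at t = - s / q when s <> 0; the + 1
   covers q = 0 *)
have := psdM (v + (- (s / (q + 1))) *: w); rewrite expand.
have q1_gt0 : 0 < q + 1 by lra.
have -> : 2 * - (s / (q + 1)) * s + (- (s / (q + 1))) ^+ 2 * q
   = - (s ^+ 2 * ((q + 2) / (q + 1) ^+ 2)) by field; rewrite gt_eqF.
rewrite oppr_ge0 pmulr_lle0 ?divr_gt0 ?exprn_gt0 //; last lra.
by rewrite real_exprn_even_le0 ?num_real // => /eqP.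
Qed.

(** The Rayleigh bound. A real symmetric matrix is Hermitian over the complex
    numbers, so it is diagonal in a unitary basis with real diagonal entries;
    these are roots of the characteristic polynomial of M, hence real
    eigenvalues, and the bound is read off in the coordinates y = P v. *)
Lemma qform_le_eigenvalue (R : realType) n (M : 'M[R]_n) (r : R) :
  M^T = M -> (forall mu, eigenvalue M mu -> mu <= r) ->
  forall v, qform M v <= r * dot v v.
Proof.
move=> symM le_r v; pose toC := real_complex R.
pose A := map_mx toC M.
have conjToC m p (B : 'M[R]_(m, p)) : map_mx Num.conj (map_mx toC B) = map_mx toC B.
  by apply/matrixP => i j; rewrite !mxE; apply: conjc_real.
have hermA : A \is hermsymmx.
  apply/is_hermitianmxP; rewrite expr0 scale1r.
  by rewrite /A map_trmx symM conjToC.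
have realD := hermitian_spectral_diag_real hermA.
have /hermitian_normalmx/orthomx_spectralP := hermA.
set P := spectralmx A in realD *; set D := spectral_diag A in realD * => Adef.
have unitP : P \in unitmx by apply: spectral_unit.
have PA : P *m A = diag_mx D *m P by rewrite {1}Adef !mulmxA mulmxV // mul1mx.
have Dle i : D 0 i <= toC r.
  have /mxOverP/(_ 0 i)/complex_realP[k Dk] := realD.
  rewrite Dk lecR le_r //.
  have : eigenvalue A (D 0 i).
    apply/eigenvalueP; exists (row i P).
      by rewrite -row_mul PA row_mul row_diag_mx -scalemxAl -rowE.
    apply/eqP => Pi0; have /(congr1 (row i)) := mulmxV unitP.
    rewrite row_mul Pi0 mul0mx => /rowP/(_ i)/eqP.
    by rewrite !mxE eqxx eq_sym oner_eq0.
  by rewrite Dk !eigenvalue_root_char -map_char_poly fmorph_root.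
pose x := map_mx toC v; pose y := P *m x.
have invP : invmx P = (P^t*)%sesqui by apply/invmx_unitary/spectral_unitarymx.
have yt : x^T *m invmx P = (y^t*)%sesqui.
  by rewrite invP /y trmx_mul map_mxM /x map_trmx conjToC.
have qA : toC (qform M v) = \sum_i D 0 i * `|y i 0| ^+ 2.
  have -> : toC (qform M v) = (x^T *m A *m x) 0 0.
    by rewrite /x /A map_trmx -!map_mxM [RHS]mxE.
  rewrite Adef !mulmxA yt -[_ *m P *m x]mulmxA -/y mxE; apply: eq_bigr => i _.
  by rewrite mul_mx_diag !mxE normCK; ring.
have dA : toC (dot v v) = \sum_i `|y i 0| ^+ 2.
  have -> : toC (dot v v) = (x^T *m invmx P *m P *m x) 0 0.
    by rewrite -[_ *m P]mulmxA mulVmx // mulmx1 /x map_trmx -!map_mxM [RHS]mxE.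
  rewrite yt -mulmxA -/y mxE; apply: eq_bigr => i _.
  by rewrite !mxE normCK mulrC.
rewrite -lecR rmorphM /= -/toC qA dA mulr_sumr.
by apply: ler_sum => i _; rewrite ler_wpM2r // exprn_ge0.
Qed.

(** * Weighted Laplacians *)

Lemma mulmx_ones (R : realType) n (W : 'M[R]_n) (i : 'I_n) :
  (W *m ones R n) i 0 = \sum_j W i j.
Proof. by rewrite mxE; apply: eq_bigr => j _; rewrite mxE mulr1. Qed.

Lemma row_sum_laplacian_ones (R : realType) n (W : 'M[R]_n) :
  (diag_mx (W *m ones R n)^T - W) *m ones R n = 0.
Proof.
by apply/colP => i; rewrite mulmxBl mul_diag_mx !mxE mulr1 subrr.
Qed.

(** The form is half the sum of W i j (v i - v j)^2. *)
Lemma row_sum_laplacian_psd (R : realType) n (W : 'M[R]_n) (v : 'cV[R]_n) :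
  W^T = W -> (forall i j, 0 <= W i j) ->
  0 <= qform (diag_mx (W *m ones R n)^T - W) v.
Proof.
move=> symW W_ge0.
suff -> : qform (diag_mx (W *m ones R n)^T - W) v
    = 2^-1 * \sum_i \sum_j W i j * (v i 0 - v j 0) ^+ 2.
  rewrite mulr_ge0 // ?invr_ge0 // sumr_ge0 // => i _; rewrite sumr_ge0 // => j _.
  by rewrite mulr_ge0 // sqr_ge0.
have -> : qform (diag_mx (W *m ones R n)^T - W) v
    = \sum_i \sum_j W i j * (v i 0 ^+ 2 - v i 0 * v j 0).
  rewrite qform_dot dotE; apply: eq_bigr => i _.
  rewrite mulmxBl mul_diag_mx !mxE.
  under [in RHS]eq_bigr do rewrite mulrBr.
  rewrite [RHS]sumrB -mulr_suml mulrBr mulr_sumr; congr (_ - _).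
    rewrite mulrC -mulrA -expr2; congr (_ * _).
    by apply: eq_bigr => j _; rewrite mxE mulr1.
  by apply: eq_bigr => j _; rewrite mulrCA.
(* symmetrizing in i and j turns v i ^ 2 - v i v j into half a square *)
have swap : \sum_i \sum_j W i j * (v i 0 ^+ 2 - v i 0 * v j 0)
   = \sum_i \sum_j W i j * (v j 0 ^+ 2 - v i 0 * v j 0).
  rewrite exchange_big /=; apply: eq_bigr => i _; apply: eq_bigr => j _.
  by rewrite -[in LHS]symW mxE [v j 0 * _]mulrC.
apply: (@mulfI _ 2); rewrite ?pnatr_eq0 // mulVKf ?pnatr_eq0 //.
rewrite mulr2n mulrDl mul1r [X in _ + X = _]swap -big_split.
apply: eq_bigr => i _; rewrite -big_split.
by apply: eq_bigr => j _ /=; ring.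
Qed.

Lemma laplacian_row_sum (R : realType) n (e : rel 'I_n) :
  laplacian R e = diag_mx (adjacency R e *m ones R n)^T - adjacency R e.
Proof.
congr (diag_mx _ - _); apply/rowP => i; rewrite !mxE -sum1_card natr_sum.
rewrite big_mkcond; apply: eq_bigr => j _.
by rewrite !mxE mulr1 inE; case: (e i j).
Qed.

(** Ld = Ld L Ld, so the form of Ld at v is that of L at Ld v. *)
Lemma pinv_psd (R : realType) n (e : rel 'I_n) (Ld : 'M[R]_n) :
  symmetric e -> is_laplacian_pinv e Ld -> forall v, 0 <= qform Ld v.
Proof.
move=> sym_e [symLd LLd LdL Ld1] v.
have <- : qform (laplacian R e) (Ld *m v) = qform Ld v.
  rewrite /qform trmx_mul symLd !mulmxA -[_ *m Ld *m laplacian R e]mulmxA LdL.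
  have oneLd : (ones R n)^T *m Ld = 0 by rewrite -symLd -trmx_mul Ld1 trmx0.
  rewrite -[v^T *m _ *m Ld]mulmxA mulmxBl mul1mx -scalemxAl.
  by rewrite -[_ *m _ *m Ld]mulmxA oneLd mulmx0 scaler0 subr0.
rewrite laplacian_row_sum; apply: row_sum_laplacian_psd => [|i j].
  by apply/matrixP => i j; rewrite !mxE sym_e.
by rewrite mxE ler0n.
Qed.

(** * The resistance Laplacian *)

Lemma resistance_mx_sym (R : realType) n (Ld : 'M[R]_n) :
  Ld^T = Ld -> (resistance_mx Ld)^T = resistance_mx Ld.
Proof.
move=> symLd; apply/matrixP => i j; rewrite !mxE.
by rewrite -[in Ld j i]symLd mxE [Ld j j + _]addrC.
Qed.

(** The resistance between i and j is the form of Ld at the difference of the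
    basis vectors i and j. *)
Lemma resistance_ge0 (R : realType) n (Ld : 'M[R]_n) :
  Ld^T = Ld -> (forall v, 0 <= qform Ld v) -> forall i j, 0 <= resistance_mx Ld i j.
Proof.
move=> symLd psdLd i j.
suff -> : resistance_mx Ld i j = qform Ld (delta_mx i 0 - delta_mx j 0) by [].
have entry k l : ((delta_mx k 0 : 'cV[R]_n)^T *m Ld *m (delta_mx l 0 : 'cV[R]_n)) 0 0
    = Ld k l.
  by rewrite trmx_delta -rowE -colE !mxE.
have subE (A B : 'M[R]_1) : (A - B) 0 0 = A 0 0 - B 0 0 by rewrite !mxE.
have Ldji : Ld j i = Ld i j by rewrite -[in LHS]symLd mxE.
rewrite /qform [(_ - _)^T]raddfB /= !mulmxBl !mulmxBr.
by rewrite !subE !entry Ldji mxE; ring.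
Qed.

Lemma resistance_laplacian_sym (R : realType) n (Ld : 'M[R]_n) :
  Ld^T = Ld -> (resistance_laplacian Ld)^T = resistance_laplacian Ld.
Proof.
move=> symLd.
by rewrite /resistance_laplacian raddfB /= tr_diag_mx resistance_mx_sym.
Qed.

(** The i-th row sum of the resistance matrix is n (Ld i i) + tr Ld, because
    the rows of Ld sum to zero; subtracting the resistance matrix itself gives
    2 Ld and the rank-two term. *)
Lemma resistance_laplacianE (R : realType) n (Ld : 'M[R]_n) :
  (0 < n)%N -> Ld *m ones R n = 0 ->
  let d : 'cV[R]_n := \col_i Ld i i in
  resistance_laplacian Ld
    = n%:R *: resistance_deviation Ld + 2 *: Ld + (2 * n%:R * dbar Ld)%:M
      - (d *m (ones R n)^T + ones R n *m d^T).
Proof.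
move=> n_gt0 Ld1 d.
rewrite /resistance_laplacian.
have n_neq0 : n%:R != 0 :> R by rewrite pnatr_eq0 -lt0n.
have -> : resistance_mx Ld *m ones R n = \col_i (n%:R * Ld i i + n%:R * dbar Ld).
  apply/colP => i; rewrite mulmx_ones mxE; under eq_bigr do rewrite mxE.
  rewrite sumrB big_split /= -mulr_sumr -mulmx_ones Ld1 mxE mulr0 subr0.
  by rewrite sumr_const card_ord [_ * Ld i i]mulr_natl /dbar mulVKf.
have -> : d *m (ones R n)^T + ones R n *m d^T = \matrix_(i, j) (Ld i i + Ld j j).
  by apply/matrixP => i j; rewrite !mxE !big_ord1 !mxE mulr1 mul1r.
apply/matrixP => i j; rewrite /resistance_deviation !mxE.
by case: (i == j) / eqP => [->|_]; rewrite ?mulr1n ?mulr0n; ring.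
Qed.

(** * Compression to the nontrivial eigenvectors *)

Lemma ord_nextE m (j : 'I_m) : @ord_next m.+1 j = lift ord0 j.
Proof. exact: val_inj. Qed.

Lemma U_mx_gram (R : realType) n (u : 'I_n -> 'cV[R]_n) :
  (forall i j, dot (u i) (u j) = (i == j)%:R) -> (U_mx u)^T *m U_mx u = 1%:M.
Proof.
move=> orthU; apply/matrixP => i j; rewrite mxE [RHS]mxE.
have -> : (i == j) = (ord_next i == ord_next j) by rewrite -!val_eqE.
by rewrite -orthU dotE; apply: eq_bigr => k _; rewrite !mxE.
Qed.

(** All the eigenvectors together form an orthogonal matrix W; removing the
    contribution of the constant column from W W^T = I leaves U U^T. *)
Lemma U_mx_projector (R : realType) m (u : 'I_m.+1 -> 'cV[R]_m.+1) :
  (forall i j, dot (u i) (u j) = (i == j)%:R) ->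
  u ord0 = (Num.sqrt m.+1%:R)^-1 *: ones R m.+1 ->
  U_mx u *m (U_mx u)^T
    = 1%:M - m.+1%:R^-1 *: (ones R m.+1 *m (ones R m.+1)^T).
Proof.
move=> orthU u0; pose W : 'M[R]_m.+1 := \matrix_(i, j) u j i 0.
have WtW : W^T *m W = 1%:M.
  apply/matrixP => i j; rewrite mxE [RHS]mxE -orthU dotE.
  by apply: eq_bigr => k _; rewrite !mxE.
apply/eqP; rewrite eq_sym subr_eq -(mulmx1C WtW); apply/eqP/matrixP => i j.
rewrite mxE big_ord_recl [RHS]mxE addrC; congr (_ + _).
  rewrite !mxE u0 !mxE big_ord1 !mxE !mulr1.
  by rewrite -invfM -expr2 sqr_sqrtr ?ler0n.
by rewrite mxE; apply: eq_bigr => k _; rewrite !mxE ord_nextE.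
Qed.

Lemma U_mx_ones (R : realType) m (u : 'I_m.+1 -> 'cV[R]_m.+1) :
  (forall i j, dot (u i) (u j) = (i == j)%:R) ->
  u ord0 = (Num.sqrt m.+1%:R)^-1 *: ones R m.+1 ->
  (ones R m.+1)^T *m U_mx u = 0.
Proof.
move=> orthU u0.
have -> : (ones R m.+1)^T = Num.sqrt m.+1%:R *: (u ord0)^T.
  by rewrite u0 [(_ *: _)^T]linearZ /= scalerA divff ?scale1r // sqrtr_eq0 -ltNge ltr0n.
rewrite -scalemxAl; apply/eqP; rewrite scaler_eq0; apply/orP; right; apply/eqP.
apply/rowP => j; rewrite !mxE.
transitivity (dot (u ord0) (u (lift ord0 j))); last by rewrite orthU.
by rewrite dotE; apply: eq_bigr => k _; rewrite !mxE ord_nextE.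
Qed.

(** L U = U diag(lam), and Ld L fixes U because U is orthogonal to 1; the
    nontrivial eigenvalues are positive, so diag(lam) can be moved across. *)
Lemma U_mx_pinv (R : realType) m (e : rel 'I_m.+1) (Ld : 'M[R]_m.+1) lam u :
  is_laplacian_pinv e Ld -> is_laplacian_eigensystem e lam u ->
  Ld *m U_mx u = U_mx u *m DL_mx lam.
Proof.
move=> [_ _ LdL _] [Lu orthU u0 lam1 lam_mono].
have [_ u0E] := u0 ord0 erefl.
have U1 := U_mx_ones orthU u0E.
have lam_gt0 (j : 'I_m) : 0 < lam (ord_next (n := m.+1) j).
  have m_gt0 : (1 < m.+1)%N by rewrite ltnS (leq_ltn_trans _ (ltn_ord j)).
  apply: lt_le_trans (lam1 (Ordinal m_gt0) erefl) _.
  by apply: lam_mono; rewrite ord_nextE.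
have LdLU : Ld *m laplacian R e *m U_mx u = U_mx u.
  by rewrite LdL mulmxBl mul1mx -scalemxAl -mulmxA U1 mulmx0 scaler0 subr0.
have LU : laplacian R e *m U_mx u = U_mx u *m diag_mx (\row_j lam (ord_next j)).
  apply/matrixP => i j.
  transitivity ((laplacian R e *m u (ord_next j)) i 0).
    by rewrite mxE [RHS]mxE; apply: eq_bigr => k _; rewrite [U_mx u k j]mxE.
  by rewrite Lu mul_mx_diag !mxE mulrC.
have lamK : diag_mx (\row_j lam (ord_next j)) *m DL_mx lam = 1%:M.
  apply/matrixP => i j; rewrite mul_diag_mx !mxE.
  by case: (i == j); rewrite ?mulr0 ?mulr0n // mulr1n divff // gt_eqF.
by rewrite -{2}LdLU -[Ld *m _ *m U_mx u]mulmxA LU -!mulmxA lamK mulmx1.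
Qed.

(** The image of calR is orthogonal to 1, so calR U = U (U^T calR U); and
    sandwiching [resistance_laplacianE] between U^T and U kills its rank-two
    term and turns Ld into D_L. *)
Lemma resistance_laplacian_U (R : realType) m (e : rel 'I_m.+1)
    (Ld : 'M[R]_m.+1) lam u :
  is_laplacian_pinv e Ld -> is_laplacian_eigensystem e lam u ->
  resistance_laplacian Ld *m U_mx u
    = U_mx u *m (2 *: DL_mx lam + m.+1%:R *: ML_mx Ld u
                 + (2 * m.+1%:R * dbar Ld)%:M).
Proof.
move=> hLd hu; have LdU := U_mx_pinv hLd hu.
case: hLd hu => [symLd _ _ Ld1] [_ orthU u0 _ _]; have [_ u0E] := u0 ord0 erefl.
have U1 := U_mx_ones orthU u0E; have UtU := U_mx_gram orthU.
set calR := resistance_laplacian Ld.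
have oneR : (ones R m.+1)^T *m calR = 0.
  rewrite /calR -(resistance_laplacian_sym symLd) -trmx_mul.
  by rewrite row_sum_laplacian_ones trmx0.
(* the range of calR is orthogonal to ones, where U U^T acts as the identity *)
have -> : calR *m U_mx u = U_mx u *m ((U_mx u)^T *m calR *m U_mx u).
  rewrite !mulmxA (U_mx_projector orthU u0E) [in RHS]mulmxBl mul1mx -scalemxAl.
  by rewrite -[_ *m _ *m calR]mulmxA oneR mulmx0 scaler0 subr0.
congr (_ *m _).
have tU1 : (U_mx u)^T *m ones R m.+1 = 0 by rewrite -[LHS]trmxK trmx_mul trmxK U1 trmx0.
rewrite /calR resistance_laplacianE // mulmxBr mulmxBl.
rewrite [X in _ - X](_ : _ = 0) ?subr0; last first.
  by rewrite mulmxDr mulmxDl !mulmxA tU1 mul0mx -!mulmxA U1 !mulmx0 mul0mx addr0.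
rewrite !mulmxDr !mulmxDl -!scalemxAr -!scalemxAl mul_mx_scalar -scalemxAl UtU.
rewrite -[_ *m Ld *m _]mulmxA LdU mulmxA UtU mul1mx scalemx1.
by rewrite /ML_mx [X in X + _]addrC.
Qed.

(** * The variational characterization *)

Theorem theorem2p15 (R : realType) (n : nat) (hn : (2 <= n)%N)
    (e : rel 'I_n) (he : is_simple_graph e) (hconn : is_connected e)
    (Ld : 'M[R]_n) (hLd : is_laplacian_pinv e Ld)
    (rho : R) (hrho : is_lambda_max (resistance_laplacian Ld) rho)
    (lam : 'I_n -> R) (u : 'I_n -> 'cV[R]_n)
    (hu : is_laplacian_eigensystem e lam u)
    (a : 'cV[R]_n.-1) :
  (unit_eigenvector (resistance_laplacian Ld) rho (U_mx u *m a)
     <-> is_sphere_maximizer (objective Ld lam u) a)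
  /\
  (is_sphere_maximizer (objective Ld lam u) a
     <-> enorm a = 1 /\
         (2 *: DL_mx lam + n%:R *: ML_mx Ld u) *m a
           = (rho - 2 * n%:R * dbar Ld) *: a).
Proof.
case: n hn e he hconn Ld hLd hrho lam u hu a => // m _ e [sym_e _] _ Ld hLd.
move=> [eig_rho rho_max] lam u hu a.
have RU := resistance_laplacian_U hLd hu.
have psdLd := pinv_psd sym_e hLd.
case: hLd hu => [symLd _ _ _] [_ orthU u0 _ _]; have [_ u0E] := u0 ord0 erefl.
have UtU := U_mx_gram orthU; have UUt := U_mx_projector orthU u0E.
have symR := resistance_laplacian_sym symLd.
have psdR v : 0 <= qform (resistance_laplacian Ld) v.
  apply: row_sum_laplacian_psd; first exact: resistance_mx_sym.
  exact: resistance_ge0.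
have R1 : resistance_laplacian Ld *m ones R m.+1 = 0.
  exact: row_sum_laplacian_ones.
have rayleigh := qform_le_eigenvalue symR rho_max.
set calR := resistance_laplacian Ld in eig_rho RU symR psdR R1 rayleigh *.
set U := U_mx u in RU UtU UUt *.
set B := 2 *: DL_mx lam + m.+1%:R *: ML_mx Ld u in RU *.
set c := 2 * m.+1%:R * dbar Ld in RU *.
have dotU b b' : dot (U *m b) (U *m b') = dot b b'.
  by rewrite /dot trmx_mul mulmxA -[_ *m U]mulmxA UtU mulmx1.
have RUb b : calR *m (U *m b) = U *m (B *m b + c *: b).
  by rewrite mulmxA RU -mulmxA mulmxDl mul_scalar_mx.
have objE b : objective Ld lam u b = qform calR (U *m b) - c * dot b b.
  have qB : objective Ld lam u b = qform B b.
    rewrite /objective /qform /B mulmxDr mulmxDl -!scalemxAr -!scalemxAl.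
    move: (_ *m DL_mx _ *m _) (_ *m ML_mx _ _ *m _) => X Y.
    by rewrite !mxE.
  rewrite qB !qform_dot RUb dotU /dot mulmxDr -scalemxAr.
  move: (b^T *m (B *m b)) (b^T *m b) => X Y.
  by rewrite !mxE addrK.
have U_inj b : U *m b = 0 -> b = 0.
  by move=> Ub; rewrite -[b]mul1mx -UtU -mulmxA Ub mulmx0.
have eigE b : calR *m (U *m b) = rho *: (U *m b) <-> B *m b = (rho - c) *: b.
  rewrite RUb scalerBl; split=> [/eqP|->]; last by rewrite subrK scalemxAr.
  rewrite scalemxAr -subr_eq0 -mulmxBr => /eqP/U_inj/eqP.
  by rewrite subr_eq0 => /eqP <-; rewrite addrK.
have max_eig : is_sphere_maximizer (objective Ld lam u) a
    <-> enorm a = 1 /\ calR *m (U *m a) = rho *: (U *m a).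
  split=> -[a1 a_max]; split=> //; last first.
    move=> b /enorm_eq1 b1; move/enorm_eq1: a1 => a1.
    rewrite !objE a1 b1 lerD2r [leRHS]qform_dot a_max.
    by rewrite dotZr (le_trans (rayleigh _)) // !dotU a1 b1.
  move/enorm_eq1: a1 => a1.
  have rho_le : rho <= qform calR (U *m a).
    have [->|rho_neq0] := eqVneq rho 0; first exact: psdR.
    have /eigenvalueP[v vR v_neq0] := eig_rho.
    have Rv : calR *m v^T = rho *: v^T by rewrite -symR -trmx_mul vR linearZ.
    (* eigenvectors of the symmetric calR for 0 and rho <> 0 are orthogonal *)
    have v1 : (ones R m.+1)^T *m v^T = 0.
      apply/eqP; have : rho *: ((ones R m.+1)^T *m v^T) == 0.
        by rewrite scalemxAr -Rv mulmxA -symR -trmx_mul R1 trmx0 mul0mx.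
      by rewrite scaler_eq0 (negPf rho_neq0).
    pose b := U^T *m v^T.
    have Ub : U *m b = v^T.
      rewrite /b mulmxA UUt mulmxBl mul1mx -scalemxAl -mulmxA v1 mulmx0.
      by rewrite scaler0 subr0.
    have b_gt0 : 0 < dot b b.
      rewrite lt_def dot_ge0 andbT; apply: contra_neq v_neq0 => /dot_eq0 b0.
      by rewrite -[v]trmxK -Ub b0 mulmx0 trmx0.
    (* normalized, b is a competitor of value rho - c *)
    pose k := (Num.sqrt (dot b b))^-1.
    have kb : dot (k *: b) (k *: b) = 1.
      rewrite dotZl dotZr mulrA.
      by rewrite -invfM -expr2 sqr_sqrtr ?ltW // mulVf // gt_eqF.
    have := a_max (k *: b); rewrite enorm_eq1 => /(_ kb).
    rewrite !objE a1 kb lerD2r [leLHS]qform_dot.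
    have -> : calR *m (U *m (k *: b)) = rho *: (U *m (k *: b)).
      by rewrite -scalemxAr Ub -scalemxAr Rv scalerA mulrC -scalerA.
    by rewrite dotZr dotU kb mulr1.
  have qform_rho : qform calR (U *m a) = rho.
    by apply/eqP; rewrite eq_le rho_le (le_trans (rayleigh _)) // dotU a1 mulr1.
  apply/esym/eqP; rewrite -subr_eq0 -mul_scalar_mx -mulmxBl; apply/eqP.
  apply: psd_kernel => [|w|].
  - by rewrite raddfB /= tr_scalar_mx symR.
  - by rewrite qform_scalar_sub subr_ge0 rayleigh.
  - by rewrite qform_scalar_sub dotU a1 mulr1 qform_rho subrr.
split; last by rewrite max_eig eigE.
rewrite max_eig /unit_eigenvector.
have -> : enorm (U *m a) = 1 <-> enorm a = 1 by rewrite !enorm_eq1 dotU.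
by [].
Qed.
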